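(* Every traceable graph is $\mathsf{LF}$-coverable.
   Context: All graphs are finite, simple and undirected. A graph $G$ on $n$ vertices is traceable if it contains the path $P_n$ on $n$ vertices (i.e. has a Hamiltonian path). A linear forest is a graph every connected component of which is a path (a single vertex is a path). A linear forest in $G$ is a subgraph of $G$ that is a linear forest; it is called maximal if no other linear forest in $G$ has a greater number of edges. $\mathsf{LF}$-cover: let $F$ be a maximal linear forest in $G$ and $S\subseteq V(F)$. The pair $(F,S)$ is an $\mathsf{LF}$-cover of $G$ if: (1) no vertex in $S$ is a leaf of $F$, where a leaf of $F$ means a vertex of degree at most $1$ in $F$ (so isolated vertices of $F$ count as leaves); (2) no two vertices in $S$ are adjacent in $F$; (3) for every edge $\{i,j\}\in E(G)$, either at least one of $i,j$ belongs to $S$, or both $i$ and $j$ belong to the same connected component of $F\setminus S$. $G$ is $\mathsf{LF}$-coverable if it has an $\mathsf{LF}$-cover. *)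

(* Defs.v *)
From mathcomp Require Import all_boot.

Set Implicit Arguments.
Unset Strict Implicit.
Unset Printing Implicit Defensive.

(* The vertices form an arbitrary subset of the ambient finType, so that a graph
   and its subgraphs inhabit the same type. *)
Record graph (T : finType) := Graph {
  vertices : {set T};
  edges : {set {set T}};
  edges_wf : forall e, e \in edges -> e \subset vertices /\ #|e| = 2
}.

(* Irreflexive, since [set x; x] has cardinality 1. *)
Definition adj (T : finType) (G : graph T) : rel T :=
  [rel x y | [set x; y] \in edges G].

Definition degree (T : finType) (G : graph T) (x : T) : nat :=
  #|[set y | adj G x y]|.

Definition subgraph (T : finType) (H G : graph T) : Prop :=
  vertices H \subset vertices G /\ edges H \subset edges G.

Lemma induced_wf (T : finType) (G : graph T) (A : {set T}) (e : {set T}) :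
  e \in [set e in edges G | e \subset A] ->
  e \subset vertices G :&: A /\ #|e| = 2.
Proof.
rewrite inE => /andP[/edges_wf[sV c2] sA]; split=> //.
by rewrite subsetI sV sA.
Qed.

Definition induced (T : finType) (G : graph T) (A : {set T}) : graph T :=
  Graph (@induced_wf T G A).

Definition delete_vertices (T : finType) (G : graph T) (S : {set T}) : graph T :=
  induced G (~: S).

Definition same_component (T : finType) (G : graph T) (x y : T) : bool :=
  [&& x \in vertices G, y \in vertices G & connect (adj G) x y].

(* Meaningful only for x \in vertices G. *)
Definition component (T : finType) (G : graph T) (x : T) : graph T :=
  induced G [set y | same_component G x y].

(* H is a copy of the path P_n, whose vertices are 0, ..., n - 1. *)
Definition is_path (T : finType) (n : nat) (H : graph T) : Prop :=
  exists f : 'I_n -> T,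
    [/\ injective f,
        vertices H = [set f i | i : 'I_n] &
        forall i j : 'I_n,
          adj H (f i) (f j) = (i.+1 == j :> nat) || (j.+1 == i :> nat)].

Definition traceable (T : finType) (G : graph T) : Prop :=
  exists H : graph T, subgraph H G /\ is_path #|vertices G| H.

Definition linear_forest (T : finType) (F : graph T) : Prop :=
  forall x, x \in vertices F -> exists n, is_path n (component F x).

Definition linear_forest_in (T : finType) (G F : graph T) : Prop :=
  subgraph F G /\ linear_forest F.

Definition maximal_linear_forest (T : finType) (G F : graph T) : Prop :=
  linear_forest_in G F /\
  forall F' : graph T, linear_forest_in G F' -> #|edges F'| <= #|edges F|.

Definition leaf (T : finType) (F : graph T) (x : T) : bool :=
  (x \in vertices F) && (degree F x <= 1).

Definition LF_cover (T : finType) (G F : graph T) (S : {set T}) : Prop :=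
  [/\ maximal_linear_forest G F /\ S \subset vertices F,
      forall x, x \in S -> ~~ leaf F x,
      forall x y, x \in S -> y \in S -> ~~ adj F x y &
      forall i j, adj G i j ->
        (i \in S \/ j \in S) \/ same_component (delete_vertices F S) i j].

Definition LF_coverable (T : finType) (G : graph T) : Prop :=
  exists (F : graph T) (S : {set T}), LF_cover G F S.

(* Main.v *)
Require Import Defs.
From mathcomp Require Import all_boot.

Set Implicit Arguments.
Unset Strict Implicit.
Unset Printing Implicit Defensive.

(** A Hamiltonian path [H] of [G], together with the empty set [S], is an
    LF-cover. Conditions (1) and (2) are vacuous, and (3) holds because [H] is
    connected and spans [G], so that any two vertices of [G] lie in the same
    component of [H] ([path_same_component]).

    What has to be shown is that [H] is a maximal linear forest. It has at least
    [#|V(G)| - 1] edges ([path_edges_ge]), so it suffices that a linear forest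
    [F] has at most [#|V(F)| - 1] edges ([linear_forest_edges_le]). This is a
    degree count: all degrees in [F] are at most 2, and in the component of any
    one vertex, a path with [n] vertices, they add up to at most [2 * (n - 1)].
    Hence the degree sum is at most [2 * (#|V(F)| - 1)], and it is twice the
    number of edges ([edges_degree_sum]). *)

Section Graphs.

Variable T : finType.
Implicit Types (G H F : graph T) (x y : T) (A : {set T}).

Lemma adj_sym G : symmetric (adj G).
Proof. by move=> x y; rewrite /adj /= setUC. Qed.

Lemma adj_vertices G x y :
  adj G x y -> (x \in vertices G) && (y \in vertices G).
Proof. by case/edges_wf=> /subsetP sV _; rewrite !sV ?set21 ?set22. Qed.

Lemma adj_induced G A x y :
  adj (induced G A) x y = [&& adj G x y, x \in A & y \in A].
Proof. by rewrite /adj /= inE subUset !sub1set. Qed.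

Lemma mem_component F x y :
  (y \in vertices (component F x)) = same_component F x y.
Proof.
by rewrite !inE /same_component; case: (y \in _); rewrite ?andbF.
Qed.

Lemma component_degree F x y :
  same_component F x y -> degree (component F x) y = degree F y.
Proof.
move=> xy; apply: eq_card => z; rewrite !inE adj_induced !inE xy.
apply/andb_idr=> yz; have /andP[_ zV] := adj_vertices yz.
case/and3P: xy => xV _ cxy; rewrite /same_component xV zV.
exact: connect_trans cxy (connect1 yz).
Qed.

(** Double counting of the incident pairs of a vertex and an edge; the
    inequality is all that a bound on the number of edges requires. *)
Lemma edges_degree_sum G :
  2 * #|edges G| <= \sum_(x in vertices G) degree G x.
Proof.
have -> : 2 * #|edges G| = \sum_(e in edges G) \sum_(x in vertices G) (x \in e).
  rewrite mulnC -sum_nat_const; apply: eq_bigr => e /edges_wf[sV <-].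
  rewrite -sum1_card [RHS]big_mkcond [LHS]big_mkcond; apply: eq_bigr => x _.
  by case: ifP => [/(subsetP sV)-> //|_]; case: ifP.
rewrite exchange_big; apply: leq_sum => x _ /=.
rewrite -big_mkcondr sum1_card.
apply: leq_trans (leq_imset_card (fun y => [set x; y]) [set y | adj G x y]).
apply/subset_leq_card/subsetP=> e; rewrite -topredE /= => /andP[eE xe].
have [_ /eqP/cards2P[a [b [_ De]]]] := edges_wf eE.
move: xe; rewrite De !inE => /orP[]/eqP Dx; apply/imsetP.
  by exists b; rewrite ?inE /adj /= Dx -?De.
by exists a; rewrite ?inE /adj /= Dx setUC -?De.
Qed.

(** The path with [n] vertices has a vertex before position [i] when [0 < i],
    and one after it when [i + 1 < n]; the bound is kept in this form so that it
    can be summed over the positions. *)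
Lemma path_vertex_degree n H (f : 'I_n -> T) :
    vertices H = [set f i | i : 'I_n] ->
    (forall i j : 'I_n, adj H (f i) (f j) = (i.+1 == j) || (j.+1 == i)) ->
  forall i : 'I_n, degree H (f i) <= (0 < i) + (i.+1 < n).
Proof.
move=> HV Hadj i.
pose P := [set j : 'I_n | j.+1 == i]; pose Q := [set j : 'I_n | i.+1 == j].
have cardP : #|P| <= (0 < i).
  case: (posnP i) => [i0|_].
    by rewrite leqn0 cards_eq0; apply/eqP/setP=> j; rewrite !inE i0.
  apply/card_le1_eqP=> j k; rewrite !inE => /eqP <- /eqP[jk].
  exact: val_inj.
have cardQ : #|Q| <= (i.+1 < n).
  case: ltnP => [_|ni].
    apply/card_le1_eqP=> j k; rewrite !inE => /eqP ij /eqP ik.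
    by apply: val_inj; rewrite /= -ij -ik.
  rewrite leqn0 cards_eq0; apply/eqP/setP=> j; rewrite !inE.
  by apply/eqP=> ij; have := ltn_ord j; rewrite -ij ltnNge ni.
apply: leq_trans (leq_add cardP cardQ).
apply: leq_trans (leq_trans (leq_imset_card f (P :|: Q)) (leq_card_setU _ _)).
apply/subset_leq_card/subsetP=> y; rewrite inE => adjy.
have /andP[_] := adj_vertices adjy; rewrite HV => /imsetP[j _ Dy].
by move: adjy; rewrite Dy Hadj orbC => PQj; apply/imset_f; rewrite !inE.
Qed.

Lemma path_degree_le2 n H x : is_path n H -> x \in vertices H -> degree H x <= 2.
Proof.
case=> f [_ HV Hadj]; rewrite {1}HV => /imsetP[i _ ->].
apply: leq_trans (path_vertex_degree HV Hadj i) _.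
by case: (0 < i); case: (_ < n).
Qed.

Lemma path_card n H : is_path n H -> #|vertices H| = n.
Proof. by case=> f [f_inj -> _]; rewrite card_imset // card_ord. Qed.

Lemma path_degree_sum n H :
  is_path n H -> \sum_(x in vertices H) degree H x <= 2 * n.-1.
Proof.
case=> f [f_inj HV Hadj]; rewrite {1}HV big_imset /=; last exact: in2W.
rewrite (eq_bigl xpredT) //.
apply: (@leq_trans (\sum_(i < n) ((0 < i) + (i.+1 < n)))).
  by apply: leq_sum => i _; apply: path_vertex_degree HV Hadj i.
case: n {f f_inj HV Hadj} => [|n] /=.
  by rewrite (eq_bigl xpred0) ?big_pred0_eq // => -[].
rewrite big_split /= big_ord_recl [X in _ + X <= _]big_ord_recr /=.
rewrite ltnn addn0 add0n mul2n -addnn leq_add //.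
  by rewrite (eq_bigr (fun=> 1)) ?sum1_card ?card_ord.
rewrite (eq_bigr (fun=> 1)) ?sum1_card ?card_ord // => i _.
by rewrite /= ltnS ltn_ord.
Qed.

(** Joining consecutive positions of the path maps the first [n - 1] of them
    injectively to edges. *)
Lemma path_edges_ge n H : is_path n H -> n.-1 <= #|edges H|.
Proof.
case=> f [f_inj _ Hadj]; case: n f f_inj Hadj => [//|n] f f_inj Hadj /=.
pose e (i : 'I_n) := [set f (widen_ord (leqnSn n) i); f (lift ord0 i)].
have e_inj : injective e.
  have mem_e (k : 'I_n.+1) i :
      (f k \in e i) = (k == i :> nat) || (k == i.+1 :> nat).
    by rewrite !inE !(inj_eq f_inj) -!val_eqE /= /bump leq0n.
  (* The first end of [e i] is one of the positions [j] and [j + 1] of the ends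
     of [e j]. *)
  have le_e i j : e i = e j -> j <= i.
    move=> eij; have := mem_e (widen_ord (leqnSn n) i) j.
    by rewrite -eij mem_e /= eqxx => /esym/orP[]/eqP->.
  by move=> i j eij; apply/val_inj/eqP; rewrite eqn_leq !le_e.
rewrite -{1}[n]card_ord -(card_imset predT e_inj).
apply/subset_leq_card/subsetP=> _ /imsetP[i _ ->].
have := Hadj (widen_ord (leqnSn n) i) (lift ord0 i).
by rewrite /= /bump leq0n eqxx.
Qed.

Lemma path_same_component n H x y :
  is_path n H -> x \in vertices H -> y \in vertices H -> same_component H x y.
Proof.
move=> [f [_ HV Hadj]] xV yV; rewrite /same_component xV yV /=.
move: xV yV; rewrite HV => /imsetP[i _ ->] /imsetP[j _ ->] {x y HV}.
have sym := sym_connect_sym (@adj_sym H).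
wlog ij : i j / i <= j => [le_ij|].
  by case/orP: (leq_total i j) => /le_ij //; rewrite sym.
case: j ij => m; elim: m => [|m IHm] mn /=.
  by rewrite leqn0 => /eqP i0; rewrite (_ : Ordinal mn = i) //; apply/val_inj.
rewrite leq_eqVlt => /orP[/eqP im|im].
  by rewrite (_ : Ordinal mn = i) //; apply/val_inj.
apply: connect_trans (IHm (ltnW mn) im) (connect1 _).
by rewrite Hadj /= eqxx.
Qed.

(** A path is connected, hence is its own unique component. *)
Lemma path_linear_forest n H : is_path n H -> linear_forest H.
Proof.
move=> pH x xV; exists n; have conn := path_same_component pH.
have VC : vertices (component H x) = vertices H.
  apply/setP=> y; rewrite mem_component; apply/idP/idP => [/and3P[] //|].
  exact: conn.
case: (pH) => f [f_inj HV Hadj]; exists f; split; rewrite ?VC // => i j.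
have fV k : f k \in vertices H by rewrite HV imset_f.
by rewrite adj_induced !inE !conn // !andbT.
Qed.

(** Degrees are at most 2, and the two missing units are found at the ends of the
    component of any single vertex. The predecessor [.-1] makes the bound correct
    for the empty forest as well. *)
Lemma linear_forest_edges_le F :
  linear_forest F -> #|edges F| <= #|vertices F|.-1.
Proof.
move=> lF; rewrite -(leq_pmul2l (_ : 0 < 2)) //.
apply: leq_trans (edges_degree_sum F) _.
have [->|[x xV]] := set_0Vmem (vertices F); first by rewrite big_set0.
have deg2 y : y \in vertices F -> degree F y <= 2.
  move=> yV; have yy : same_component F y y by rewrite /same_component yV /=.
  have [m pm] := lF y yV.
  by rewrite -(component_degree yy) (path_degree_le2 pm) ?mem_component.
have [n pn] := lF x xV; set C := vertices (component F x).
have CV : C \subset vertices F by apply: subsetIl.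
have C_gt0 : 0 < #|C|.
  by apply/card_gt0P; exists x; rewrite mem_component /same_component xV /=.
rewrite (big_setID C) /= (setIidPr CV).
have sumC : \sum_(y in C) degree F y <= 2 * #|C|.-1.
  rewrite (path_card pn); apply: leq_trans (path_degree_sum pn).
  apply: leq_sum => y; rewrite mem_component => xy.
  by rewrite component_degree.
have sumD : \sum_(y in vertices F :\: C) degree F y <= 2 * #|vertices F :\: C|.
  rewrite mulnC -sum_nat_const; apply: leq_sum => y /setDP[yV _]; exact: deg2.
apply: leq_trans (leq_add sumC sumD) _.
rewrite -mulnDr -[#|vertices F|](cardsID C) (setIidPr CV).
by case: #|C| C_gt0.
Qed.

End Graphs.

Theorem proposition2p20 (T : finType) (G : graph T) :
  traceable G -> LF_coverable G.
Proof.
case=> H [HG pH]; have [sV sE] := HG.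
have VH : vertices H = vertices G.
  by apply/eqP; rewrite eqEcard sV (path_card pH) leqnn.
exists H, set0; split=> [|x|x y|i j Gij]; try by rewrite inE.
  split; last exact: sub0set.
  split=> [|F [[sFV _] lF]]; first by split=> //; apply: path_linear_forest pH.
  apply: leq_trans (path_edges_ge pH).
  apply: leq_trans (linear_forest_edges_le lF) _.
  by rewrite -!subn1 leq_sub2r // subset_leq_card.
right; have /andP[iV jV] := adj_vertices Gij; rewrite -VH in iV jV.
have /and3P[_ _ cij] := path_same_component pH iV jV.
rewrite /same_component !inE iV jV /=.
by rewrite (eq_connect (e' := adj H)) // => x y; rewrite adj_induced !inE andbT.
Qed.
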